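(* Let $A=\mathbb{Z}[X,Y,Z]/(X^2-X+YZ)$, and let $x,y,z\in A$ be the classes of $X,Y,Z$. Let $f:A^2\to A^2$ be the $A$-linear map with matrix $$\begin{pmatrix}x & z\\ y & 1-x\end{pmatrix},$$ and let $L=\operatorname{Im}(f)$. Then $L$ is an invertible $A$-module, and $L$ is not free.
   Context: An $A$-module is called invertible if it is projective, finitely generated and of rank $1$. Here a finitely generated $A$-module $L$ has rank $n$ if for every prime ideal $\mathfrak{p}$ of $A$, with $\kappa(\mathfrak{p})$ the fraction field of $A/\mathfrak{p}$, the $\kappa(\mathfrak p)$-vector space $(L/\mathfrak{p}L)_{\mathfrak{p}}=\kappa(\mathfrak{p})\otimes_A L$ has dimension $n$. *)

(* Defs.v *)
(* MathComp, with classical logic from boolp: `[< P >] is the truth value of the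
   proposition P, so boolean predicates are arbitrary subsets.                *)
From HB Require Import structures.
From mathcomp Require Import all_boot all_order all_algebra boolp.
From mathcomp Require Import freeg mpoly.

Set Implicit Arguments.
Unset Strict Implicit.
Unset Printing Implicit Defensive.

Import GRing.Theory.
Local Open Scope ring_scope.
Local Open Scope quotient_scope.

(* The lifting property; g ranges over the surjective A-linear maps. *)
Definition projective_module (A : comNzRingType) (M : lmodType A) : Prop :=
  forall (N P : lmodType A) (g : {linear N -> P}) (h : {linear M -> P}),
    (forall p, exists n, g n = p) ->
  exists h' : {linear M -> N}, forall m, g (h' m) = h m.

Definition finitely_generated (A : comNzRingType) (M : lmodType A) : Prop :=
  exists (n : nat) (e : 'I_n -> M),
    forall m, exists c : 'I_n -> A, m = \sum_(i < n) c i *: e i.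

Definition basis_of_module (A : comNzRingType) (M : lmodType A) (B : {pred M}) :
    Prop :=
  (forall m, exists (s : seq M) (c : M -> A),
      {subset s <= B} /\ m = \sum_(b <- s) c b *: b) /\
  (forall (s : seq M) (c : M -> A), uniq s -> {subset s <= B} ->
      \sum_(b <- s) c b *: b = 0 -> {in s, forall b, c b = 0}).

(* B may be infinite. *)
Definition free_module (A : comNzRingType) (M : lmodType A) : Prop :=
  exists B : {pred M}, basis_of_module B.

(* prime_idealr is MathComp's type of (proper) prime ideals. MathComp does not
   make the quotient by one an integral domain because inverses of units need
   not be computable; here they are chosen classically.                       *)
Definition residue_domain (A : comNzRingType) (p : prime_idealr A) : Type :=
  {ideal_quot p}.

Section ResidueDomain.
Variables (A : comNzRingType) (p : prime_idealr A).
Local Notation D := (residue_domain p).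

HB.instance Definition _ := GRing.ComNzRing.on D.

Definition residue_unit : {pred D} := fun x => `[< exists y, y * x = 1 >].

Definition residue_inv (x : D) : D :=
  if pselect (exists y, y * x == 1) is left xV then xchoose xV else x.

Lemma residue_mulVx : {in residue_unit, left_inverse 1 residue_inv *%R}.
Proof.
move=> x /asboolP[y yx1]; rewrite /residue_inv.
case: pselect => [xV|[]]; first exact/eqP/(xchooseP xV).
by exists y; apply/eqP.
Qed.

Lemma residue_unitPl (x y : D) : y * x = 1 -> residue_unit x.
Proof. by move=> yx1; apply/asboolP; exists y. Qed.

Lemma residue_invr_out : {in [predC residue_unit], residue_inv =1 id}.
Proof.
move=> x /negP xNunit; rewrite /residue_inv; case: pselect => // xV.
by case: xNunit; apply/asboolP; case: xV => y /eqP yx1; exists y.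
Qed.

HB.instance Definition _ := GRing.ComNzRing_hasMulInverse.Build D
  residue_mulVx residue_unitPl residue_invr_out.

Lemma residue_integral : GRing.integral_domain_axiom D.
Proof. exact: Quotient.rquot_IdomainAxiom. Qed.

HB.instance Definition _ :=
  GRing.ComUnitRing_isIntegral.Build D residue_integral.

End ResidueDomain.

Notation "\kappa( p )" := {fraction (residue_domain p)}
  (at level 8, format "\kappa( p )") : type_scope.

Section ResidueMap.
Variables (A : comNzRingType) (p : prime_idealr A).

Definition residue_class (a : A) : residue_domain p := \pi_{ideal_quot p} a.

Lemma residue_class_is_zmod_morphism : zmod_morphism residue_class.
Proof. exact: (rmorphB (\pi_{ideal_quot p})). Qed.

Lemma residue_class_is_monoid_morphism : monoid_morphism residue_class.
Proof.
by split; [exact: (rmorph1 (\pi_{ideal_quot p})) |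
           exact: (rmorphM (\pi_{ideal_quot p}))].
Qed.

HB.instance Definition _ := GRing.isZmodMorphism.Build A (residue_domain p)
  residue_class residue_class_is_zmod_morphism.
HB.instance Definition _ := GRing.isMonoidMorphism.Build A (residue_domain p)
  residue_class residue_class_is_monoid_morphism.

Definition residue_map : {rmorphism A -> \kappa(p)} :=
  @FracField.tofrac (residue_domain p) \o residue_class.

End ResidueMap.

(* The K-module K (x)_A M, where K is an A-algebra through phi: the free abelian
   group on the pairs (k, m) modulo the subgroup generated by the bilinearity
   relations, with K acting on the left factor.                               *)
Section TensorProduct.
Variables (A K : comNzRingType) (phi : {rmorphism A -> K}) (M : lmodType A).

Local Notation F := {freeg (K * M)%type}.

Definition tensor_gen (k : K) (m : M) : F := Freeg [:: (1, (k, m))].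

Variant tensor_relator : F -> Prop :=
| TensorAddl k k' m :
    tensor_relator (tensor_gen (k + k') m - (tensor_gen k m + tensor_gen k' m))
| TensorAddr k m m' :
    tensor_relator (tensor_gen k (m + m') - (tensor_gen k m + tensor_gen k m'))
| TensorBalance a k m :
    tensor_relator (tensor_gen (k * phi a) m - tensor_gen k (a *: m)).

(* The smallest subgroup of F containing the relators. *)
Definition tensor_null : {pred F} := fun u =>
  `[< forall S : F -> Prop, S 0 -> (forall v w, S v -> S w -> S (v - w)) ->
        (forall v, tensor_relator v -> S v) -> S u >].

Lemma tensor_null_zmod_closed : zmod_closed tensor_null.
Proof.
split=> [|u v /asboolP Nu /asboolP Nv]; apply/asboolP => S S0 SB SR //.
exact: SB (Nu S S0 SB SR) (Nv S S0 SB SR).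
Qed.

HB.instance Definition _ :=
  GRing.isZmodClosed.Build F tensor_null tensor_null_zmod_closed.

Definition tensor : Type := {ideal_quot tensor_null}.

HB.instance Definition _ := GRing.Zmodule.on tensor.

Definition tens (k : K) (m : M) : tensor := \pi_tensor (tensor_gen k m).

Lemma pi_tensorB (u v : F) :
  \pi_tensor (u - v) = (\pi_tensor u : tensor) - \pi_tensor v.
Proof. exact: (raddfB (\pi_{ideal_quot tensor_null})). Qed.

Lemma pi_tensorD (u v : F) :
  \pi_tensor (u + v) = (\pi_tensor u : tensor) + \pi_tensor v.
Proof. exact: (raddfD (\pi_{ideal_quot tensor_null})). Qed.

Lemma pi_tensor_eq (u v : F) :
  (u - v \in tensor_null) = (\pi_tensor u == \pi_tensor v).
Proof. exact: Quotient.idealrBE. Qed.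

(* The endomorphism of F sending the generator (k, m) to (c * k, m). *)
Definition tensor_free_scale (c : K) : F -> F :=
  fglift (fun km : K * M => tensor_gen (c * km.1) km.2).

Lemma tensor_free_scaleB c u v :
  tensor_free_scale c (u - v) = tensor_free_scale c u - tensor_free_scale c v.
Proof. exact: lift_is_additive. Qed.

Lemma tensor_free_scale0 c : tensor_free_scale c 0 = 0.
Proof. by have := tensor_free_scaleB c 0 0; rewrite !subrr. Qed.

Lemma tensor_free_scaleD c u v :
  tensor_free_scale c (u + v) = tensor_free_scale c u + tensor_free_scale c v.
Proof.
by rewrite -[v in LHS]opprK -[- v]sub0r !tensor_free_scaleB tensor_free_scale0
  sub0r opprK.
Qed.

Lemma tensor_free_scale_gen c k m :
  tensor_free_scale c (tensor_gen k m) = tensor_gen (c * k) m.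
Proof. by rewrite /tensor_free_scale {1}/tensor_gen liftU scale1r. Qed.

Lemma tensor_free_ind (P : F -> Prop) :
    P 0 -> (forall u v, P u -> P v -> P (u - v)) ->
    (forall k m, P (tensor_gen k m)) ->
  forall u, P u.
Proof.
move=> P0 PB Pgen u.
have PN v : P v -> P (- v) by move=> Pv; rewrite -sub0r; apply: PB.
have PD v w : P v -> P w -> P (v + w).
  by move=> Pv /PN Pw; rewrite -[w]opprK; apply: PB.
rewrite -[u]freeg_sumE; elim/big_ind: _ => // -[k m] _.
move: (coeff _ u) => z.
have PM n : P (Freeg [:: (n%:Z, (k, m))]).
  rewrite -[n%:Z]natz -freegU_muln; elim: n => [|n IHn].
    by rewrite mulr0n.
  by rewrite mulrS; apply: PD => //; apply: Pgen.
case: z => n; first exact: PM.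
by rewrite NegzE -freegUN; apply: PN; apply: PM.
Qed.

Lemma tensor_free_scale_null c u :
  u \in tensor_null -> tensor_free_scale c u \in tensor_null.
Proof.
move=> /asboolP Nu; apply/asboolP => S S0 SB SR.
apply: (Nu (fun v => S (tensor_free_scale c v))).
- by rewrite tensor_free_scale0.
- by move=> v w Sv Sw; rewrite tensor_free_scaleB; apply: SB.
move=> v [k k' m|k m m'|a k m]; apply: SR;
  rewrite tensor_free_scaleB ?tensor_free_scaleD !tensor_free_scale_gen.
- by rewrite mulrDr; constructor.
- by constructor.
- by rewrite mulrA; constructor.
Qed.

Definition tensor_scale (c : K) (t : tensor) : tensor :=
  \pi_tensor (tensor_free_scale c (repr t)).

Lemma tensor_scale_pi c u :
  tensor_scale c (\pi_tensor u) = \pi_tensor (tensor_free_scale c u).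
Proof.
apply/eqP; rewrite -pi_tensor_eq -tensor_free_scaleB.
by apply: tensor_free_scale_null; rewrite pi_tensor_eq reprK.
Qed.

Lemma tensor_scaleDr : right_distributive tensor_scale +%R.
Proof.
move=> c; elim/quotW => u; elim/quotW => v.
by rewrite -pi_tensorD !tensor_scale_pi tensor_free_scaleD pi_tensorD.
Qed.

Lemma tensor_ind (P : tensor -> Prop) :
    P 0 -> (forall s t, P s -> P t -> P (s - t)) ->
    (forall k m, P (tens k m)) ->
  forall t, P t.
Proof.
move=> P0 PB Ptens; elim/quotW; elim/tensor_free_ind => [|u v Pu Pv|//].
  by have := pi_tensorB 0 0; rewrite !subrr => ->.
by rewrite pi_tensorB; apply: PB.
Qed.

Lemma tensor_scaleE c k m : tensor_scale c (tens k m) = tens (c * k) m.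
Proof. by rewrite tensor_scale_pi tensor_free_scale_gen. Qed.

Lemma tensDl k k' m : tens (k + k') m = tens k m + tens k' m.
Proof.
apply/eqP; rewrite /tens -pi_tensorD -pi_tensor_eq.
by apply/asboolP => S _ _; apply; constructor.
Qed.

Lemma tensDr k m m' : tens k (m + m') = tens k m + tens k m'.
Proof.
apply/eqP; rewrite /tens -pi_tensorD -pi_tensor_eq.
by apply/asboolP => S _ _; apply; constructor.
Qed.

Lemma tensZ a k m : tens (k * phi a) m = tens k (a *: m).
Proof.
apply/eqP; rewrite /tens -pi_tensor_eq.
by apply/asboolP => S _ _; apply; constructor.
Qed.

Lemma tensor_scale0 c : tensor_scale c 0 = 0.
Proof. by apply: (addrI (tensor_scale c 0)); rewrite -tensor_scaleDr !addr0. Qed.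

Lemma tensor_scaleB c s t :
  tensor_scale c (s - t) = tensor_scale c s - tensor_scale c t.
Proof. by apply: (addIr (tensor_scale c t)); rewrite -tensor_scaleDr !subrK. Qed.

Lemma tensor_scaleA b c t :
  tensor_scale b (tensor_scale c t) = tensor_scale (b * c) t.
Proof.
elim/tensor_ind: t => [|s t IHs IHt|k m]; first by rewrite !tensor_scale0.
  by rewrite !tensor_scaleB IHs IHt.
by rewrite !tensor_scaleE mulrA.
Qed.

Lemma tensor_scale1 : left_id 1 tensor_scale.
Proof.
elim/tensor_ind => [|s t IHs IHt|k m]; first by rewrite tensor_scale0.
  by rewrite tensor_scaleB IHs IHt.
by rewrite tensor_scaleE mul1r.
Qed.

Lemma tensor_scaleDl t : {morph tensor_scale^~ t : b c / b + c}.
Proof.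
move=> b c; elim/tensor_ind: t => [|s t IHs IHt|k m].
- by rewrite !tensor_scale0 addr0.
- by rewrite !tensor_scaleB IHs IHt opprD addrACA.
- by rewrite !tensor_scaleE mulrDl tensDl.
Qed.

HB.instance Definition _ := GRing.Zmodule_isLmodule.Build K tensor
  tensor_scaleA tensor_scale1 tensor_scaleDr tensor_scaleDl.

End TensorProduct.

(* The dimension of kappa(p) (x)_A M over kappa(p) is n for every prime p;
   Vector.axiom n V is the type of linear bijections from V to 'rV_n.           *)
Definition has_rank (A : comNzRingType) (n : nat) (M : lmodType A) : Prop :=
  forall p : prime_idealr A,
    inhabited (Vector.axiom n (tensor (residue_map p) M)).

Definition invertible_module (A : comNzRingType) (M : lmodType A) : Prop :=
  [/\ projective_module M, finitely_generated M & has_rank 1 M].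

Section LinearImage.
Variables (A : comNzRingType) (U V : lmodType A) (f : {linear U -> V}).

Definition linear_image_pred : {pred V} := fun v => `[< exists u, v = f u >].

Lemma linear_image_submod_closed : submod_closed linear_image_pred.
Proof.
split=> [|a _ _ /asboolP[u ->] /asboolP[v ->]]; apply/asboolP.
  by exists 0; rewrite linear0.
by exists (a *: u + v); rewrite linearP.
Qed.

HB.instance Definition _ := GRing.isSubmodClosed.Build A V linear_image_pred
  linear_image_submod_closed.

Definition linear_image : Type := {v : V | v \in linear_image_pred}.

HB.instance Definition _ := SubChoice.on linear_image.
HB.instance Definition _ :=
  [SubChoice_isSubLmodule of linear_image by <:].

End LinearImage.

(* X^2 - X + YZ, with X, Y, Z the variables of index 0, 1, 2. *)
Definition quadric : {mpoly int[3]} :=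
  'X_(inord 0) ^+ 2 - 'X_(inord 0) + 'X_(inord 1) * 'X_(inord 2).

Definition quadric_ideal : {pred {mpoly int[3]}} :=
  fun q => `[< exists r, q = r * quadric >].

Lemma quadric_idealr_closed : idealr_closed quadric_ideal.
Proof.
split=> [||a _ _ /asboolP[r ->] /asboolP[s ->]].
- by apply/asboolP; exists 0; rewrite mul0r.
- apply/asboolP => -[r /(congr1 (mmap idfun (fun=> 0)))].
  rewrite !(rmorph1, rmorphM, rmorphD, rmorphN, rmorphXn) /= !mmapX !mmap1U.
  by rewrite mulr0 => /eqP; rewrite oner_eq0.
- by apply/asboolP; exists (a * r + s); rewrite mulrDl mulrA.
Qed.

HB.instance Definition _ := isIdealr.Build {mpoly int[3]} quadric_ideal
  quadric_idealr_closed.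

Definition quadric_ring : Type := {ideal_quot quadric_ideal}.

HB.instance Definition _ := GRing.ComNzRing.on quadric_ring.

Definition quadric_class (q : {mpoly int[3]}) : quadric_ring :=
  \pi_{ideal_quot quadric_ideal} q.

Lemma quadric_class_is_zmod_morphism : zmod_morphism quadric_class.
Proof. exact: (rmorphB (\pi_{ideal_quot quadric_ideal})). Qed.

Lemma quadric_class_is_monoid_morphism : monoid_morphism quadric_class.
Proof.
by split; [exact: (rmorph1 (\pi_{ideal_quot quadric_ideal})) |
           exact: (rmorphM (\pi_{ideal_quot quadric_ideal}))].
Qed.

HB.instance Definition _ := GRing.isZmodMorphism.Build {mpoly int[3]}
  quadric_ring quadric_class quadric_class_is_zmod_morphism.
HB.instance Definition _ := GRing.isMonoidMorphism.Build {mpoly int[3]}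
  quadric_ring quadric_class quadric_class_is_monoid_morphism.

(* Main.v *)
Require Import Defs.
From HB Require Import structures.
From mathcomp Require Import all_boot all_order all_algebra boolp ring zify.
From mathcomp Require Import freeg mpoly.

(* The matrix M of f has trace 1 and vanishing 2 x 2 minors.  Hence M is
   idempotent, and L is a direct summand of A^2; modulo each prime some diagonal
   entry M i i is nonzero, and column i then spans L, so L has rank 1.  Elements
   u, v of L satisfy v_i u = u_i v, so a basis of L has at most one element and
   would give a factorization M i j = b i * c j.
   The map A -> Z[sqrt(-6)] sending x, y, z to 3, sqrt(-6), sqrt(-6) would turn
   b 0 into a generator of the ideal (3, sqrt(-6)), which has norm 3; but 3 is
   not of the form a^2 + 6 b^2. *)

Set Implicit Arguments.
Unset Strict Implicit.
Unset Printing Implicit Defensive.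

Import GRing.Theory Num.Theory.
Local Open Scope ring_scope.
Local Open Scope quotient_scope.

(** * Scalar extensions of dimension one *)

Section TensorRank.
Variables (A : comNzRingType) (K : fieldType) (phi : {rmorphism A -> K}).
Variable M : lmodType A.

(** Universal property of the tensor product: (k, m) -> k * g m extends additively to the free
    abelian group and kills the bilinearity relators. *)
Lemma tensor_lift (g : M -> K) :
    {morph g : m n / m + n} -> (forall a m, g (a *: m) = phi a * g m) ->
  exists2 G : tensor phi M -> K^o,
    linear G & forall k m, G (tens phi k m) = k * g m.
Proof.
move=> gD gZ.
pose G0 : {freeg (K * M)%type} -> zmodule K :=
  fglift (fun km => km.1 * g km.2 : zmodule K).
have G0gen k m : G0 (tensor_gen k m) = k * g m.
  by rewrite /G0 /tensor_gen liftU scale1r.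
have G0B u v : G0 (u - v) = G0 u - G0 v by exact: lift_is_additive.
have G00 : G0 0 = 0 by have := G0B 0 0; rewrite !subrr.
have G0D u v : G0 (u + v) = G0 u + G0 v.
  by rewrite -[v in LHS]opprK -[- v]sub0r !G0B G00 sub0r opprK.
have G0null u : u \in tensor_null phi (M := M) -> G0 u = 0.
  move=> /asboolP Nu.
  (* The kernel of [G0] is a subgroup, so it contains [tensor_null] as soon as it contains the three
     kinds of relators. *)
  apply: (Nu (fun v => G0 v = 0)) => // [v w v0 w0|v [k k' m|k m m'|a k m]].
  - by rewrite G0B v0 w0 subrr.
  - by rewrite G0B G0D !G0gen mulrDl subrr.
  - by rewrite G0B G0D !G0gen gD mulrDr subrr.
  - by rewrite G0B !G0gen gZ mulrA subrr.
pose G (t : tensor phi M) : K^o := G0 (repr t).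
have Gpi u : G (\pi_(tensor phi M) u) = G0 u.
  apply/eqP; rewrite -subr_eq0 -G0B; apply/eqP/G0null.
  by rewrite pi_tensor_eq reprK.
have Gtens k m : G (tens phi k m) = k * g m by rewrite Gpi G0gen.
have GB s t : G (s - t) = G s - G t.
  by elim/quotW: s => u; elim/quotW: t => v; rewrite -pi_tensorB !Gpi G0B.
have G_0 : G 0 = 0 by have := GB 0 0; rewrite !subrr.
have GN s : G (- s) = - G s by rewrite -sub0r GB G_0 sub0r.
have GZ c t : G (c *: t) = c * G t.
  elim/tensor_ind: t => [|s t IHs IHt|k m]; first by rewrite scaler0 G_0 mulr0.
    by rewrite scalerBr !GB IHs IHt mulrBr.
  by rewrite [_ *: _]tensor_scaleE !Gtens mulrA.
exists G => // c s t.
by rewrite -[t in LHS]opprK GB GN GZ opprK.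
Qed.

(** The lift of [g] sends [tens phi k e] to [k * g e]. Every tensor has the form [tens phi c e], so
    division by [g e] gives the inverse. *)
Lemma tensor_rank1 (g : M -> K) (e : M) :
    {morph g : m n / m + n} -> (forall a m, g (a *: m) = phi a * g m) ->
    g e != 0 -> (forall k m, exists c, tens phi k m = tens phi c e) ->
  inhabited (Vector.axiom 1 (tensor phi M)).
Proof.
move=> gD gZ ge0 span_e; have [G Glin Gtens] := tensor_lift gD gZ.
have span t : exists c, t = tens phi c e.
  elim/tensor_ind: t => [|_ _ [c ->] [d ->]|//].
    by exists 0; apply: (addrI (tens phi 0 e)); rewrite -tensDl !addr0.
  exists (c - d); apply: (addIr (tens phi d e)).
  by rewrite -tensDl !subrK.
constructor; exists (fun t => (G t)%:M).
  by move=> c s t /=; rewrite Glin raddfD /= -scale_scalar_mx.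
exists (fun r : 'rV_1 => tens phi (r 0 0 / g e) e) => [t|r].
  have [c ->] := span t.
  by rewrite !mxE eqxx mulr1n Gtens mulfK.
by rewrite Gtens mulfVK //; apply/rowP => i; rewrite !mxE ord1 eqxx mulr1n.
Qed.

End TensorRank.

(** * Images of square matrices; the idempotent case *)

Section MatrixImage.
Variables (A : comNzRingType) (n : nat) (M : 'M[A]_n).

Let f : {linear 'cV[A]_n -> 'cV[A]_n} := mulmx M.
Let L : lmodType A := linear_image f.

Lemma linear_image_mem (u : 'cV[A]_n) : f u \in linear_image_pred f.
Proof. by apply/asboolP; exists u. Qed.

Definition image_col (i : 'I_n) : L :=
  Sub (f (delta_mx i 0)) (linear_image_mem _).

Lemma image_sum (l : L) (u : 'cV[A]_n) :
  val l = f u -> l = \sum_i u i 0 *: image_col i.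
Proof.
move=> lE; apply: val_inj; rewrite lE.
rewrite [val (\sum_i _)]raddf_sum /= {1}[u]matrix_sum_delta linear_sum /=.
by apply: eq_bigr => i _; rewrite big_ord1 -scalemxAr.
Qed.

Lemma finitely_generated_image : finitely_generated L.
Proof.
exists n, image_col => l; have /asboolP[u lu] := valP l.
by exists (u^~ 0); apply: image_sum.
Qed.

Hypothesis M_idem : M *m M = M.

Lemma image_fixed (l : L) : f (val l) = val l.
Proof. by have /asboolP[u ->] := valP l; rewrite /f /= mulmxA M_idem. Qed.

(** Choose a lift [w i] of the image under [h] of each column and send l to the sum of the l_i
    [w i]. This lifts [h] because l = M l is the combination of the columns with coefficients
    l_i. *)
Lemma projective_image : projective_module L.
Proof.
move=> N P g h g_surj.
have [w gw] := choice (fun i => g_surj (h (image_col i))).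
pose h' (l : L) : N := \sum_i val l i 0 *: w i.
have h'_lin : linear h'.
  move=> a l m; rewrite /h' scaler_sumr -big_split /=; apply: eq_bigr => i _.
  by rewrite !mxE scalerDl scalerA.
pose h'L := GRing.isLinear.Build _ _ _ _ h' h'_lin.
pose H : {linear L -> N} := HB.pack h' h'L.
exists H => l; rewrite [in RHS](image_sum (esym (image_fixed l))).
rewrite /H /= /h' !linear_sum; apply: eq_bigr => i _.
by rewrite !linearZ /= gw.
Qed.

End MatrixImage.

(** * Matrices of trace 1 with vanishing 2 x 2 minors *)

Section RankOneMatrixImage.
Variables (A : comNzRingType) (n : nat) (M : 'M[A]_n).

Hypothesis minor0 : forall i j k l, M i j * M k l = M i l * M k j.
Hypothesis trM : \tr M = 1.

Let L : lmodType A := linear_image (mulmx M : {linear 'cV[A]_n -> 'cV[A]_n}).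

(** Since M_ij M_jk = M_ik M_jj, summing over j gives M_ik times the trace. *)
Lemma rank_one_idem : M *m M = M.
Proof.
apply/matrixP => i k; rewrite mxE -[RHS]mulr1 -trM mulr_sumr.
by apply: eq_bigr => j _; rewrite minor0.
Qed.

Lemma image_colE i j : val (image_col M j) i 0 = M i j.
Proof. by rewrite /= -colE mxE. Qed.

(** Makes column i span after any base change in which M_ii becomes invertible. *)
Lemma pivot_image_col i j : M i i *: image_col M j = M i j *: image_col M i.
Proof.
apply: val_inj; apply/colP => k.
by rewrite ![val (_ *: _)]linearZ mxE [RHS]mxE !image_colE minor0.
Qed.

(** With u = M u and v = M v, both sides are double sums that agree term by term, as M_ik M_jl =
    M_il M_jk. *)
Lemma image_minor0 (u v : L) i j :
  val u i 0 * val v j 0 = val u j 0 * val v i 0.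
Proof.
rewrite -(image_fixed rank_one_idem u) -(image_fixed rank_one_idem v) !mxE.
rewrite !mulr_suml; under eq_bigr => k _ do rewrite mulr_sumr.
under [RHS]eq_bigr => k _ do rewrite mulr_sumr.
by apply: eq_bigr => k _; apply: eq_bigr => l _; rewrite mulrACA minor0; ring.
Qed.

Lemma has_rank1_image : has_rank 1 L.
Proof.
move=> p; set phi := residue_map p.
(* Otherwise [phi] would send 1, the trace of M, to 0. *)
have [i phi_i] : exists i, phi (M i i) != 0.
  apply/existsP; apply: contraT; rewrite negb_exists => /forallP M0.
  have /eqP := rmorph1 phi; rewrite -trM rmorph_sum big1 => [|i _].
    by rewrite eq_sym oner_eq0.
  by apply/eqP; move: (M0 i); rewrite negbK.
apply: (tensor_rank1 (g := fun l : L => phi (val l i 0)) (e := image_col M i)).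
- by move=> u v; rewrite mxE rmorphD.
- by move=> a v; rewrite mxE rmorphM.
- by rewrite image_colE.
move=> k l; rewrite (image_sum (esym (image_fixed rank_one_idem l))).
elim/big_ind: _ => [|u v [c cE] [d dE]|j _].
- by exists 0; rewrite -(scale0r (image_col M i)) -tensZ rmorph0 mulr0.
- by exists (c + d); rewrite tensDr tensDl cE dE.
(* Dividing by [phi (M i i)] frees a factor M_ii to move across the tensor sign, where the pivot
   relation trades column j for column i. *)
set c := k * phi (val l j 0) / phi (M i i).
exists (c * phi (M i j)).
by rewrite tensZ -pivot_image_col -!tensZ mulfVK.
Qed.

(** If b generates L, then column j is c_j b, and its coordinates give the factorization. *)
Lemma free_image_factor : free_module L ->
  exists b c : 'I_n -> A, forall i j, M i j = b i * c j.
Proof.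
case=> B [Bspan Bfree].
have B1 u v : u \in B -> v \in B -> u = v.
  move=> Bu Bv; case: (eqVneq u v) => // uv.
  have v0 i : val v i 0 = 0.
    (* The relation v_i u - u_i v = 0 forces v_i = 0 for every i, but a basis does not contain 0. *)
    have := Bfree [:: u; v]
      (fun w => if w == u then val v i 0 else - val u i 0).
    have s_uniq : uniq [:: u; v] by rewrite /= inE uv.
    have sB : {subset [:: u; v] <= B}.
      by move=> w; rewrite !inE => /orP[]/eqP ->.
    move=> /(_ s_uniq sB); rewrite !big_cons big_nil /= eqxx eq_sym (negbTE uv).
    rewrite addr0 => indep; rewrite -[RHS](indep _ u) ?inE ?eqxx //.
    apply: val_inj; apply/colP => j.
    rewrite -[LHS]/((val v i 0 *: val u + - val u i 0 *: val v) j 0) !mxE.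
    by rewrite mulNr image_minor0 mulrC subrr.
  have {v0} v0 : v = 0.
    by apply: val_inj; apply/colP => i; rewrite v0 mxE.
  have sB : {subset [:: v] <= B} by move=> w; rewrite inE => /eqP ->.
  have := Bfree [:: v] (fun=> 1) isT sB; rewrite big_seq1 v0 scaler0.
  by move=> /(_ erefl 0); rewrite inE => /(_ (eqxx _)) /eqP; rewrite oner_eq0.
have [b bspan] : exists b : L, forall m, exists c, m = c *: b.
  have [[b Bb]|B0] := pselect (exists b, b \in B).
    exists b => m; have [s [c [sB ->]]] := Bspan m.
    exists (\sum_(w <- s) c w); rewrite scaler_suml big_seq [RHS]big_seq.
    by apply: eq_bigr => w /sB Bw; rewrite (B1 w b).
  (* With an empty basis L is zero, and 0 generates it. *)
  exists 0 => m; have [[|w s] [c [sB ->]]] := Bspan m.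
    by exists 0; rewrite big_nil scaler0.
  by case: B0; exists w; apply: sB; rewrite inE eqxx.
have [c cE] := choice (fun j => bspan (image_col M j)).
exists (fun i => val b i 0), c => i j.
by rewrite -image_colE cE linearZ mxE mulrC.
Qed.

End RankOneMatrixImage.

(** * The ring Z[sqrt(-6)] and its norm *)

(* (a, b) stands for a + b * sqrt(-6). *)
Definition zsqrtm6 : Type := (int * int)%type.

HB.instance Definition _ := GRing.Zmodule.on zsqrtm6.

(** Only the additive group is inherited from pairs, whose own product is componentwise. *)
Definition zsqrtm6_mul (u v : zsqrtm6) : zsqrtm6 :=
  (u.1 * v.1 - 6 * (u.2 * v.2), u.1 * v.2 + u.2 * v.1).

Lemma zsqrtm6_mulA : associative zsqrtm6_mul.
Proof. by move=> u v w; congr pair => /=; ring. Qed.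

Lemma zsqrtm6_mulC : commutative zsqrtm6_mul.
Proof. by move=> u v; congr pair => /=; ring. Qed.

Lemma zsqrtm6_mul1 : left_id ((1, 0) : zsqrtm6) zsqrtm6_mul.
Proof. by case=> a b; congr pair => /=; ring. Qed.

Lemma zsqrtm6_mulDl : left_distributive zsqrtm6_mul +%R.
Proof. by move=> u v w; congr pair => /=; ring. Qed.

Lemma zsqrtm6_oner_neq0 : ((1, 0) : zsqrtm6) != 0.
Proof. by []. Qed.

HB.instance Definition _ := GRing.Zmodule_isComNzRing.Build zsqrtm6
  zsqrtm6_mulA zsqrtm6_mulC zsqrtm6_mul1 zsqrtm6_mulDl zsqrtm6_oner_neq0.

Definition zsqrtm6_norm (u : zsqrtm6) : int := u.1 ^+ 2 + 6 * u.2 ^+ 2.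

Lemma zsqrtm6_normM (u v : zsqrtm6) :
  zsqrtm6_norm (u * v) = zsqrtm6_norm u * zsqrtm6_norm v.
Proof. by rewrite /zsqrtm6_norm -[u * v]/(zsqrtm6_mul u v) /=; ring. Qed.

Lemma zsqrtm6_norm_ge0 (u : zsqrtm6) : 0 <= zsqrtm6_norm u.
Proof. by rewrite /zsqrtm6_norm addr_ge0 ?sqr_ge0 // mulr_ge0 ?sqr_ge0. Qed.

(** As 6 > 3, b must vanish, and 3 is not a square. *)
Lemma zsqrtm6_norm_neq3 (u : zsqrtm6) : zsqrtm6_norm u != 3.
Proof.
case: u => a b; rewrite /zsqrtm6_norm /= !expr2; apply/eqP => ab3.
have b0 : b = 0 by nia.
have a1 : -1 <= a <= 1 by nia.
by nia.
Qed.

Definition sqrtm6 : zsqrtm6 := (0, 1).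

(** The norm of [b0] divides 9 and 6, hence 3; not being 3, it is 1. Then [c0] has norm 9, which
    does not divide 6, the norm of [b1 * c0]. *)
Lemma zsqrtm6_ideal_nonprincipal (b0 b1 c0 c1 : zsqrtm6) :
  b0 * c0 = 3 -> b0 * c1 = sqrtm6 -> b1 * c0 = sqrtm6 -> False.
Proof.
move=> /(congr1 zsqrtm6_norm) + /(congr1 zsqrtm6_norm) + /(congr1 zsqrtm6_norm).
rewrite !zsqrtm6_normM.
move: (zsqrtm6_norm_ge0 b0) (zsqrtm6_norm_ge0 c0).
move: (zsqrtm6_norm_neq3 b0) => /eqP.
rewrite (_ : zsqrtm6_norm 3 = 9) // (_ : zsqrtm6_norm sqrtm6 = 6) //.
move: (zsqrtm6_norm b0) (zsqrtm6_norm b1) (zsqrtm6_norm c0) (zsqrtm6_norm c1).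
move=> N0 N1 P0 P1 N0_neq3 N0_ge0 P0_ge0 e1 e2 e3.
have := congr2 +%R e1 (congr1 -%R e2); rewrite -mulrBr.
move: (P0 - P1) => k N0k.
have k_gt0 : 0 < k by nia.
have N0_le3 : N0 <= 3 by nia.
have N0_neq0 : N0 <> 0 by nia.
have N0_neq2 : N0 <> 2 by move=> N0_2; rewrite N0_2 in N0k; lia.
have N0_1 : N0 = 1 by lia.
by rewrite N0_1 mul1r in e1; rewrite e1 in e3; lia.
Qed.

(** * Evaluation at a point of the quadric over Z[sqrt(-6)] *)

Definition quadric_eval (q : {mpoly int[3]}) : zsqrtm6 :=
  mmap (intmul 1) (fun i => nth 0 [:: 3; sqrtm6; sqrtm6] i) q.

Lemma quadric_evalX (i : 'I_3) :
  quadric_eval 'X_i = nth 0 [:: 3; sqrtm6; sqrtm6] i.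
Proof. by rewrite /quadric_eval mmapX mmap1U. Qed.

Lemma quadric_evalM : {morph quadric_eval : p q / p * q}.
Proof. exact: rmorphM. Qed.

Lemma quadric_evalB : {morph quadric_eval : p q / p - q}.
Proof. exact: rmorphB. Qed.

(** At (3, sqrt(-6), sqrt(-6)) the value is 9 - 3 - 6. *)
Lemma quadric_eval_quadric : quadric_eval quadric = 0.
Proof.
rewrite /quadric_eval /quadric rmorphD rmorphB rmorphXn rmorphM /=.
by rewrite -!/(quadric_eval _) !quadric_evalX !inordK.
Qed.

(** Evaluation stays on polynomials; this makes it independent of the representative of a class in
    A. *)
Lemma quadric_eval_class p q :
  quadric_class p = quadric_class q -> quadric_eval p = quadric_eval q.
Proof.
move=> pq; apply/eqP; rewrite -subr_eq0 -quadric_evalB.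
have : p - q \in quadric_ideal by rewrite Quotient.idealrBE; apply/eqP.
by move=> /asboolP[r ->]; rewrite quadric_evalM quadric_eval_quadric mulr0.
Qed.

Lemma quadric_class_surj (a : quadric_ring) : exists q, a = quadric_class q.
Proof. by exists (repr a); rewrite /quadric_class reprK. Qed.

(** * The matrix of [f], over a general commutative ring *)

Section QuadricProjector.
Variables (A : comNzRingType) (x y z : A).

Let M : 'M[A]_2 :=
  \matrix_(i, j) (nth [::] [:: [:: x; z]; [:: y; 1 - x]] i)`_j.

Lemma quadric_projector_trace : \tr M = 1.
Proof. by rewrite /mxtrace big_ord_recl big_ord1 !mxE /= addrC subrK. Qed.

Hypothesis xyz : x ^+ 2 - x + y * z = 0.

(** The only nontrivial case is the determinant x (1 - x) - y z, which the relation kills. *)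
Lemma quadric_projector_minor0 i j k l : M i j * M k l = M i l * M k j.
Proof.
have yz : y * z = x * (1 - x).
  by apply/eqP; rewrite -subr_eq0 -xyz; apply/eqP; ring.
rewrite !mxE;
  case: i j k l => [[|[|//]] ?] [[|[|//]] ?] [[|[|//]] ?] [[|[|//]] ?] /=;
  by rewrite ?[z * y]mulrC ?yz // mulrC.
Qed.

End QuadricProjector.

Theorem mainTheorem4 :
  let A : comNzRingType := quadric_ring in
  let x : A := quadric_class 'X_(inord 0) in
  let y : A := quadric_class 'X_(inord 1) in
  let z : A := quadric_class 'X_(inord 2) in
  let f : {linear 'cV[A]_2 -> 'cV[A]_2} :=
    mulmx (\matrix_(i, j) (nth [::] [:: [:: x; z]; [:: y; 1 - x]] i)`_j) in
  let L : lmodType A := linear_image f in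
  invertible_module L /\ ~ free_module L.
Proof.
move=> A x y z f L.
have xyz : x ^+ 2 - x + y * z = 0.
  rewrite -rmorphXn -rmorphB -rmorphM -rmorphD /=; apply/eqP.
  rewrite -(rmorph0 quadric_class) -Quotient.idealrBE subr0.
  by apply/asboolP; exists 1; rewrite mul1r.
have minor0 := quadric_projector_minor0 xyz.
have tr1 := quadric_projector_trace x y z.
split; first split.
- exact: projective_image (rank_one_idem minor0 tr1).
- exact: finitely_generated_image.
- exact: has_rank1_image minor0 tr1.
move=> /(free_image_factor minor0 tr1)[b [c bcE]].
have [b' b'E] := choice (fun i => quadric_class_surj (b i)).
have [c' c'E] := choice (fun i => quadric_class_surj (c i)).
(* The factorization in A is evaluated entry by entry through representatives. *)
have eval (i j : 'I_2) q :
    (nth [::] [:: [:: x; z]; [:: y; 1 - x]] i)`_j = quadric_class q ->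
    quadric_eval (b' i) * quadric_eval (c' j) = quadric_eval q.
  move=> Eq; rewrite -quadric_evalM; apply: quadric_eval_class.
  by rewrite rmorphM /= -b'E -c'E -bcE mxE.
(* The entries (0, 0), (0, 1), (1, 0) are x, z, y, with values 3, sqrt(-6), sqrt(-6). *)
apply: (@zsqrtm6_ideal_nonprincipal (quadric_eval (b' 0)) (quadric_eval (b' 1))
  (quadric_eval (c' 0)) (quadric_eval (c' 1))).
- by rewrite (eval _ _ 'X_(inord 0)) ?quadric_evalX ?inordK.
- by rewrite (eval _ _ 'X_(inord 2)) ?quadric_evalX ?inordK.
- by rewrite (eval _ _ 'X_(inord 1)) ?quadric_evalX ?inordK.
Qed.
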